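(* The set of all global solutions $\varphi$ of initial value problems of the form $x'=g(t,x)$, $x(0)=0$ with $g\in\mathrm{G}$ is precisely $\Phi$. In particular, fixing any $\vartheta\in C_0(\mathbb{R}_+,\mathbb{R})$, each $\varphi\in\Phi$ solves the initial value problem $x'=g(t,x)$, $x(0)=0$ over $\mathbb{R}_+$ when $$g(t,x):=\varphi'(\varphi^{-1}(x))+\vartheta(t)-\vartheta(\varphi^{-1}(x)).$$ Moreover $g\in\mathrm{G}$ if $\vartheta$ is strictly increasing with $\sup_{t\in\mathbb{R}_+}\vartheta(t)-\varphi'(t)=\infty$, and in this case $\varphi$ is this initial value problem's unique global solution.
   Context: $\mathbb{R}_+=[0,\infty)$. $C_0(\mathbb{R}_+,\mathbb{R})$ is the set of continuous paths starting from $0$ at time $0$, and $C^1_0(\mathbb{R}_+,\mathbb{R}_+)$ the set of continuously differentiable paths from $\mathbb{R}_+$ to $\mathbb{R}_+$ starting from $0$. $\Phi$ is the set of bijective paths in $C^1_0(\mathbb{R}_+,\mathbb{R}_+)$ (bijections of $\mathbb{R}_+$ onto itself); $\varphi^{-1}$ denotes the inverse of $\varphi\in\Phi$. $\mathrm{G}\subset C(\mathbb{R}_+^2,\mathbb{R})$ is the set of continuous $g:\mathbb{R}_+^2\to\mathbb{R}$, $(t,x)\mapsto g(t,x)$, such that: (i) $g(0,0)\ge0$; (ii) $g(\cdot,x)$ is strictly increasing for each $x\in\mathbb{R}_+$; (iii) $\inf_{x\in\mathbb{R}_+}g(t,x)<0$ for all $t\in\mathbb{R}_+$; (iv) $\sup_{t\in\mathbb{R}_+}g(t,x)>0$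 for all $x\in\mathbb{R}_+$. A global solution of $x'=g(t,x)$, $x(0)=0$ is $\varphi\in C^1_0(\mathbb{R}_+,\mathbb{R}_+)$ verifying $\varphi'(t)=g(t,\varphi(t))$ for all $t\in\mathbb{R}_+$ and $\varphi(0)=0$. *)

(* Defs.v *)
From mathcomp Require Import all_boot all_order all_algebra.
From mathcomp Require Import all_classical all_reals all_analysis.

Set Implicit Arguments.
Unset Strict Implicit.
Unset Printing Implicit Defensive.

Import Order.TTheory GRing.Theory Num.Theory.
Import numFieldNormedType.Exports.

Local Open Scope classical_set_scope.
Local Open Scope ring_scope.

(** A path on [0, +oo[ is a total function [R -> R] of which only the values on
    [0, +oo[ matter: every predicate below depends only on the restriction of
    its arguments to [0, +oo[ (resp. to [0, +oo[ x [0, +oo[). *)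

Definition Rplus (R : realType) : set R := [set` `[0, +oo[].
Arguments Rplus : clear implicits.

Section Paths.
Context {R : realType}.
Implicit Types (f phi theta : R -> R) (g : R -> R -> R) (s t x : R).

(** Increments are restricted to points of [0, +oo[, so the derivative is
    two-sided for [0 < t] and the right derivative at [t = 0]. *)
Definition diff_quot f t : R -> R := fun s => (s - t)^-1 * (f s - f t).

Definition derivable_plus f t : Prop :=
  cvg (diff_quot f t @ within (Rplus R) t^').

Definition deriv_plus f t : R :=
  lim (diff_quot f t @ within (Rplus R) t^').

Definition C0_path f : Prop :=
  {within Rplus R, continuous f} /\ f 0 = 0.

Definition C10_path f : Prop :=
  [/\ set_fun (Rplus R) (Rplus R) f,
      (forall t, Rplus R t -> derivable_plus f t),
      {within Rplus R, continuous (deriv_plus f)}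
    & f 0 = 0].

Definition strictly_increasing f : Prop :=
  {in `[0, +oo[ &, {homo f : s t / s < t}}.

Definition Phi : set (R -> R) :=
  [set phi : R -> R | C10_path phi /\ set_bij (Rplus R) (Rplus R) phi].

Definition inverse_path phi : R -> R := pinv (Rplus R) phi.

(** The infimum and the suprema are taken in the extended reals, as they may be
    infinite. *)
Definition GG : set (R -> R -> R) :=
  [set g : R -> R -> R | {within Rplus R `*` Rplus R, continuous (fun z : R * R => g z.1 z.2)}
    /\ [/\ 0 <= g 0 0,
           (forall x, Rplus R x -> strictly_increasing (g^~ x)),
           (forall t, Rplus R t ->
              (ereal_inf [set (g t x)%:E | x in Rplus R] < 0)%E)
         & (forall x, Rplus R x ->
              (0 < ereal_sup [set (g t x)%:E | t in Rplus R])%E)]].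

Definition global_solution g phi : Prop :=
  [/\ C10_path phi,
      (forall t, Rplus R t -> deriv_plus phi t = g t (phi t))
    & phi 0 = 0].

Definition field_of phi theta : R -> R -> R := fun t x =>
  deriv_plus phi (inverse_path phi x) + theta t - theta (inverse_path phi x).

End Paths.
Arguments Phi : clear implicits.
Arguments GG : clear implicits.

(* Main.v *)
(** A solution phi of x' = g(t, x) with g in G is nondecreasing: if phi' < 0 at
    some time, then phi has met the same level before, coming from below, i.e.
    with phi' >= 0, and monotonicity of g in time gives phi' > 0 at the later
    time. Constancy on an interval is excluded by monotonicity of g again, and
    boundedness by (iv), so phi is a bijection.  Conversely [field_of phi theta]
    lies in G for theta(t) = t + max_[0,t] phi' - phi'(0).  Any two solutions phi,
    psi for the same g in G agree, as seen by comparing slopes at a maximum of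
    the delay t - phi^-1 (psi t). *)
Require Import Defs.
From mathcomp Require Import all_boot all_order all_algebra.
From mathcomp Require Import all_classical all_reals all_analysis.
From mathcomp Require Import lra.
Import Order.TTheory GRing.Theory Num.Theory.
Import numFieldNormedType.Exports.
Local Open Scope classical_set_scope.
Local Open Scope ring_scope.

Section Proofs.
Context {R : realType}.
Implicit Types (f phi psi theta : R -> R) (g : R -> R -> R) (a b s t x y : R).

(** * Calculus of paths on the half-line *)

Lemma RplusE t : Rplus R t = (0 <= t) :> Prop.
Proof. by rewrite /Rplus /= in_itv /= andbT. Qed.

Lemma continuous_plusP f : {within Rplus R, continuous f} <->
  (forall t, 0 <= t -> forall e, 0 < e -> exists2 d, 0 < d &
     forall s, 0 <= s -> `|s - t| < d -> `|f s - f t| < e).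
Proof.
split=> [/subspace_continuousP cf t t0 e e0|cf].
- have := cf t; rewrite RplusE => /(_ t0) /cvgrPdist_lt /(_ e e0).
  move=> /nbhs_ballP [d /= d0 dP]; exists d => // s s0 sd.
  by rewrite distrC; apply: dP; rewrite ?RplusE// /ball/= distrC.
- apply/subspace_continuousP => t; rewrite RplusE => t0.
  apply/cvgrPdist_lt => e e0; have [d d0 dP] := cf t t0 e e0.
  apply/nbhs_ballP; exists d => //= s ts; rewrite RplusE => s0.
  by rewrite distrC; apply: dP => //; rewrite distrC.
Qed.

Lemma deriv_plus_approx f t : derivable_plus f t ->
  forall e, 0 < e -> exists2 d, 0 < d &
    forall s, 0 <= s -> s != t -> `|s - t| < d ->
      `|f s - f t - deriv_plus f t * (s - t)| < e * `|s - t|.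
Proof.
move=> /cvgrPdist_lt dft e e0.
have /nbhs_ballP [d /= d0 dP] := dft e e0.
exists d => // s s0 st sd.
have st0 : s - t != 0 by rewrite subr_eq0.
have : `|deriv_plus f t - diff_quot f t s| < e.
  by apply: dP => //; rewrite ?RplusE// /ball/= distrC.
rewrite -(@ltr_pM2r _ `|s - t|) ?normr_gt0// -normrM mulrBl /diff_quot.
by rewrite mulrAC mulVf// mul1r distrC.
Qed.

Lemma derivable_plus_continuous f : (forall t, Rplus R t -> derivable_plus f t) ->
  {within Rplus R, continuous f}.
Proof.
move=> df; apply/continuous_plusP => t t0 e e0.
have := df t; rewrite RplusE => /(_ t0) /deriv_plus_approx /(_ 1 ltr01).
case=> d d0 dP; set K := `|deriv_plus f t| + 1.
have K0 : 0 < K by rewrite ltr_wpDl.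
exists (Num.min d (e / K)); first by rewrite lt_min d0 divr_gt0.
move=> s s0; rewrite lt_min => /andP[sd sK].
have [->|st] := eqVneq s t; first by rewrite subrr normr0.
have := dP s s0 st sd; rewrite mul1r => H.
move: sK; rewrite ltr_pdivlMr// => sK; apply: le_lt_trans sK.
rewrite -[f s - f t](subrK (deriv_plus f t * (s - t))).
rewrite (le_trans (ler_normD _ _))// normrM.
by rewrite [leLHS]addrC [leRHS]mulrC /K [leRHS]mulrDl mul1r lerD2l ltW.
Qed.

(** The classical mean value theorem asks for two-sided derivatives only at interior points. These
    are positive because [0 <= a], and there [deriv_plus] is the usual derivative. *)
Lemma MVT_plus f a b : (forall t, Rplus R t -> derivable_plus f t) ->
  0 <= a -> a < b ->
  exists2 c, a < c < b & f b - f a = deriv_plus f c * (b - a).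
Proof.
move=> df a0 ab.
have [||c] := @MVT R f (deriv_plus f) a b ab.
- move=> c; rewrite in_itv/= => /andP[ac cb].
  have c0 : 0 < c by apply: le_lt_trans ac.
  suff cv : h^-1 *: ((f \o shift c) (h *: 1) - f c) @[h --> 0^'] --> deriv_plus f c.
    split; first by apply/cvg_ex; exists (deriv_plus f c).
    exact: (cvg_lim _ cv).
  apply/cvgrPdist_lt => e e0.
  have := df c; rewrite RplusE => /(_ (ltW c0)) /deriv_plus_approx /(_ e e0).
  case=> d d0 dP; apply/nbhs_ballP.
  (* A radius of at most [c] keeps [c + h] in the half-line. *)
  exists (Num.min d c); first by rewrite /= lt_min d0.
  move=> h; rewrite /ball/= sub0r normrN lt_min => /andP[hd hc] h0.
  rewrite -(@ltr_pM2r _ `|h|) ?normr_gt0// -normrM mulrBl.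
  rewrite /= [h%:A]mulr1 [_ *: _]mulrC -[X in _ - X]mulrA (mulVf h0) mulr1 distrC.
  have := dP (h + c); rewrite addrK; apply => //.
    by move: hc; rewrite ltr_norml => /andP[]; lra.
  by rewrite -subr_eq0 addrK.
- apply: continuous_subspaceW (derivable_plus_continuous _ df) => x /=.
  rewrite in_itv RplusE /= => /andP[ax _]; exact: le_trans ax.
- by rewrite in_itv/= => ? ?; exists c.
Qed.

(** Take [s] to be the supremum of the times in [[0, b]] where [f] is at most [y]. By continuity,
    [f s > y] would separate [s] from those times, and [f s < y] would produce a later one. *)
Lemma last_exit f y b : {within Rplus R, continuous f} -> 0 <= b ->
  f 0 <= y -> y < f b ->
  exists2 s, 0 <= s < b & f s = y /\ forall r, s < r <= b -> y < f r.
Proof.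
move=> /continuous_plusP cf b0 f0y yfb.
pose A := [set s | 0 <= s <= b /\ f s <= y].
have A0 : A 0 by split=> //; rewrite lexx.
have ubA : has_ubound A by exists b => s -[/andP[]].
pose s := sup A.
have s0 : 0 <= s by exact: ub_le_sup.
have sb : s <= b by apply: ge_sup; [exists 0|move=> r -[/andP[]]].
have sA r : s < r <= b -> y < f r.
  move=> /andP[sr rb]; rewrite ltNge; apply/negP => fry.
  have : r <= s by apply: ub_le_sup => //; split; rewrite ?rb ?(le_trans s0 (ltW sr)).
  by rewrite leNgt sr.
have fsy : f s <= y.
  rewrite leNgt; apply/negP => yfs.
  have e0 : 0 < f s - y by rewrite subr_gt0.
  have [d d0 dP] := cf s s0 _ e0.
  have [|r [/andP[r0 rb] fry] rs] := @sup_adherent _ A d d0.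
    by split => //; exists 0.
  have rls : r <= s by apply: ub_le_sup => //; split => //; rewrite r0.
  have : `|f r - f s| < f s - y.
    by apply: dP => //; rewrite ltr_norml -/s in rs *; apply/andP; split; lra.
  by rewrite ltr_norml => /andP[]; lra.
have slb : s < b.
  by rewrite lt_neqAle sb andbT; apply/eqP => sbE; move: yfb; rewrite -sbE; lra.
exists s; first by rewrite s0.
split=> //; apply/eqP; rewrite eq_le fsy leNgt; apply/negP => fsy'.
have e0 : 0 < y - f s by rewrite subr_gt0.
have [d d0 dP] := cf s s0 _ e0.
pose r := Num.min (s + d / 2) b.
have sr : s < r by rewrite lt_min slb andbT; lra.
have rsd : r <= s + d / 2 by rewrite ge_min lexx.
have rb : r <= b by rewrite ge_min lexx orbT.
have : `|f r - f s| < y - f s by apply: dP; rewrite ?ltr_norml; lra.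
have := sA r; rewrite sr rb => /(_ isT).
by rewrite ltr_norml => ? /andP[]; lra.
Qed.

Lemma deriv_plus_ge0 f t b : derivable_plus f t -> 0 <= t -> t < b ->
  (forall s, t < s <= b -> f t <= f s) -> 0 <= deriv_plus f t.
Proof.
move=> df t0 tb fts; rewrite leNgt; apply/negP => D0.
(* With tolerance [- deriv_plus f t] the first-order estimate gives exactly [f s < f t] for [s]
   slightly after [t]. *)
have e0 : 0 < - deriv_plus f t by rewrite oppr_gt0.
have [d d_gt0 dP] := deriv_plus_approx _ _ df _ e0.
pose s := Num.min (t + d / 2) b.
have ts : t < s by rewrite lt_min tb andbT; lra.
have std : s <= t + d / 2 by rewrite ge_min lexx.
have sb : s <= b by rewrite ge_min lexx orbT.
have /= := dP s; rewrite gt_eqF// gtr0_norm ?subr_gt0//.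
rewrite ltr_norml => /(_ ltac:(lra) isT ltac:(lra)) /andP[_].
have := fts s; rewrite ts sb => /(_ isT).
by lra.
Qed.

(** The left difference quotients over a common step [k] are ordered, since the end values agree and
    the earlier values are ordered the other way. *)
Lemma deriv_plus_le_left f h m n : derivable_plus f m -> derivable_plus h n ->
  0 < m -> 0 < n -> f m = h n ->
  (forall k, 0 < k -> k <= m -> k <= n -> h (n - k) <= f (m - k)) ->
  deriv_plus f m <= deriv_plus h n.
Proof.
move=> df dh m0 n0 fmhn hf; rewrite leNgt; apply/negP => D0.
(* Half the gap: the two errors then add up to the whole gap times [k], which contradicts the strict
   estimates. *)
pose e := (deriv_plus f m - deriv_plus h n) / 2.
have e0 : 0 < e by rewrite /e; lra.
have [d d0 dP] := deriv_plus_approx _ _ df _ e0.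
have [d' d'0 d'P] := deriv_plus_approx _ _ dh _ e0.
pose k := Num.min (Num.min m n) (Num.min d d' / 2).
have k0 : 0 < k by rewrite !lt_min m0 n0 divr_gt0// lt_min d0.
have : k <= k by []; rewrite {2}/k !le_min => /andP[/andP[km kn] kd].
have kdd' : k < Num.min d d' by rewrite (le_lt_trans kd)// ltr_pdivrMr// ltr_pMr ?ltr1n// lt_min d0.
move: kdd'; rewrite lt_min => /andP[kd1 kd2].
have nk x : `|x - k - x| = k by rewrite addrAC subrr add0r normrN gtr0_norm.
have ne x : x - k != x by rewrite -subr_eq0 addrAC subrr add0r oppr_eq0 gt_eqF.
have := dP (m - k) ltac:(lra) (ne _); rewrite nk => /(_ kd1); rewrite ltr_norml => /andP[A1 A2].
have := d'P (n - k) ltac:(lra) (ne _); rewrite nk => /(_ kd2); rewrite ltr_norml => /andP[B1 B2].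
have := hf k k0 km kn; move: A1 A2 B1 B2; rewrite /e fmhn.
by nra.
Qed.

(** * Global solutions for a field in [GG] are increasing bijections *)

Section Solution.
Variables (g : R -> R -> R) (phi : R -> R).
Hypotheses (gG : GG R g) (sol : global_solution g phi).

Lemma solution_derivable t : Rplus R t -> derivable_plus phi t.
Proof. by case: sol => -[_ + _ _] _ _; apply. Qed.

Lemma solution_continuous : {within Rplus R, continuous phi}.
Proof. exact: derivable_plus_continuous solution_derivable. Qed.

Lemma solution0 : phi 0 = 0. Proof. by case: sol. Qed.

Lemma solution_ge0 t : 0 <= t -> 0 <= phi t.
Proof. by case: sol => -[+ _ _ _] _ _ => /(_ t); rewrite !RplusE. Qed.

Lemma solutionE t : 0 <= t -> deriv_plus phi t = g t (phi t).
Proof. by case: sol => _ + _ => /(_ t); rewrite RplusE. Qed.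

Lemma GG_incr x s t : 0 <= x -> 0 <= s -> s < t -> g s x < g t x.
Proof.
case: gG => _ [_ + _ _] x0 s0 st => /(_ x); rewrite RplusE => /(_ x0) gx.
by apply: gx => //; rewrite in_itv/= andbT; lra.
Qed.

(* If phi' < 0 at t, phi last meets the level phi t from below at some s < t;
   there phi' >= 0, which monotonicity of g in time propagates to t. *)
Lemma solution_deriv_ge0 t : 0 <= t -> 0 <= deriv_plus phi t.
Proof.
rewrite le_eqVlt => /predU1P[<-|t0].
  (* At time 0 there is no earlier time to compare with; condition (i) gives the sign. *)
  by rewrite solutionE// solution0; case: gG => _ [].
rewrite leNgt; apply/negP => D0.
have dphi : derivable_plus phi t by apply: solution_derivable; rewrite RplusE ltW.
have e0 : 0 < - deriv_plus phi t by rewrite oppr_gt0.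
have [d d_gt0 dP] := deriv_plus_approx _ _ dphi _ e0.
have below r : 0 <= r -> t - d < r -> r < t -> phi t < phi r.
  move=> r0 rd rt; have /= := dP r r0; rewrite lt_eqF// ltr0_norm ?subr_lt0//.
  by rewrite ltr_norml => /(_ isT ltac:(lra)) /andP[+ _]; lra.
(* A time shortly before [t], clipped at 0, at which [phi] still exceeds [phi t]. *)
pose b := Num.max 0 (t - d / 2).
have b0 : 0 <= b by rewrite le_max lexx.
have tb : t - d / 2 <= b by rewrite le_max lexx orbT.
have bt : b < t by rewrite gt_max t0; lra.
have [||s /andP[s0 sb] [phis sP]] := last_exit phi (phi t) b solution_continuous b0.
- by rewrite solution0; exact/solution_ge0/ltW.
- by apply: (below b) => //; lra.
have : 0 <= deriv_plus phi s.
  apply: (@deriv_plus_ge0 _ _ b) => //.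
    by apply: solution_derivable; rewrite RplusE.
  by move=> r rs; rewrite phis ltW// sP.
rewrite solutionE// phis => H.
have := GG_incr (phi t) s t (solution_ge0 _ (ltW t0)) s0 (lt_trans sb bt).
by move: D0; rewrite solutionE ?ltW//; lra.
Qed.

Lemma solution_ndecr s t : 0 <= s -> s <= t -> phi s <= phi t.
Proof.
move=> s0; rewrite le_eqVlt => /predU1P[->//|st].
have [c /andP[sc ct] E] := MVT_plus _ _ _ solution_derivable s0 st.
rewrite -subr_ge0 E; apply: mulr_ge0; last by lra.
by apply: solution_deriv_ge0; lra.
Qed.

(** Otherwise [phi] is constant on [[s, t]]. The mean value theorem on each half then yields two
    distinct zeros of the strictly increasing function [g^~ (phi s)]. *)
Lemma solution_incr s t : 0 <= s -> s < t -> phi s < phi t.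
Proof.
move=> s0 st; rewrite ltNge; apply/negP => phits.
have phiE r : s <= r <= t -> phi r = phi s.
  move=> /andP[sr rt]; apply/eqP; rewrite eq_le.
  rewrite (solution_ndecr s r)// andbT (le_trans _ phits)//.
  by apply: solution_ndecr => //; lra.
have zero a b : s <= a -> a < b -> b <= t ->
    exists2 c, a < c < b & g c (phi s) = 0.
  move=> sa ab bt; have a0 : 0 <= a by lra.
  have [c /andP[ac cb] E] := MVT_plus _ _ _ solution_derivable a0 ab.
  exists c; first by rewrite ac cb.
  rewrite -(phiE c) -?solutionE; [|lra|apply/andP; split; lra].
  move: E; rewrite !phiE ?subrr; [|apply/andP; split; lra..].
  by move/esym/eqP; rewrite mulf_eq0 (gt_eqF (_ : 0 < b - a)) ?orbF ?subr_gt0// => /eqP.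
have [||c /andP[sc cm] gc] := zero s ((s + t) / 2) (lexx s); [lra|lra|].
have [|||c' /andP[mc' ct'] gc'] := zero ((s + t) / 2) t; [lra..|].
have := GG_incr (phi s) c c' (solution_ge0 _ s0).
by rewrite gc gc' ltxx => H; suff: false by []; apply: H; lra.
Qed.

(** If [phi] is bounded with supremum [l], condition (iv) and continuity give a time [T] and a bound
    [c > 0] with [g T > c] near [l]. Once [phi] is near [l] and [T] has passed, monotonicity in time
    keeps the slope above [c], so [phi] cannot stay bounded. *)
Lemma solution_unbounded M : exists2 t, 0 <= t & M < phi t.
Proof.
apply: contrapT => nex.
have phiM t : 0 <= t -> phi t <= M.
  by move=> t0; rewrite leNgt; apply/negP => ?; apply: nex; exists t.
pose A := phi @` Rplus R.
have A0 : A 0 by exists 0; rewrite ?RplusE ?solution0.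
have ubA : has_ubound A by exists M => _ [t + <-]; rewrite RplusE; exact: phiM.
pose l := sup A.
have l0 : 0 <= l by exact: ub_le_sup.
have phil t : 0 <= t -> phi t <= l.
  by move=> t0; apply: ub_le_sup => //; exists t; rewrite ?RplusE.
have [T T0 gT] : exists2 T, 0 <= T & 0 < g T l.
  case: gG => _ [_ _ _ /(_ l)]; rewrite RplusE => /(_ l0) /ereal_sup_gt.
  by case=> _ [T + <-]; rewrite RplusE lte_fin => ? ?; exists T.
pose c := g T l / 2.
have c0 : 0 < c by rewrite /c; lra.
have [d d0 dP] : exists2 d, 0 < d & forall x, 0 <= x -> `|x - l| < d -> c < g T x.
  case: gG => /subspace_continuousP /(_ (T, l)) + _.
  rewrite /= !RplusE => /(_ (conj T0 l0)) /cvgrPdist_lt /(_ c c0).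
  move=> /nbhs_ballP [d /= d0 dP]; exists d => // x x0 xd.
  have : `|g T l - g T x| < c.
    apply: (dP (T, x)); last by rewrite /= !RplusE.
    by split; [exact: ballxx|rewrite /ball/= distrC].
  by rewrite ltr_norml /c => /andP[]; lra.
have [|_ [t0 + <-] lt0] := @sup_adherent _ A d d0; first by split=> //; exists 0.
(* From [a] on, [phi] lies within [d] of [l] and time is at least [T]. *)
rewrite RplusE => t00; pose a := Num.max T t0.
have Ta : T <= a by rewrite le_max lexx.
have ta : t0 <= a by rewrite le_max lexx orbT.
have a0 : 0 <= a by lra.
(* At slope above [c], this duration raises [phi] by more than [M + 1], whereas [phi] takes values
   in [[0, M]]. *)
have ab : a < a + (M + 1) / c.
  by rewrite ltrDl divr_gt0// ltr_wpDl// (le_trans (solution_ge0 _ a0))// phiM.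
have [s /andP[sa sb] E] := MVT_plus _ _ _ solution_derivable a0 ab.
have s0 : 0 <= s by lra.
have : c < deriv_plus phi s.
  rewrite solutionE//; apply: (@lt_le_trans _ _ (g T (phi s))).
    apply: dP; first exact: solution_ge0.
    have := solution_ndecr t0 s t00 ltac:(lra); have := phil s s0; rewrite -/l in lt0.
    by rewrite ltr_norml => ? ?; apply/andP; split; lra.
  by apply/ltW/GG_incr => //; [exact: solution_ge0|lra].
rewrite -(@ltr_pM2r _ (a + (M + 1) / c - a)) ?subr_gt0// -E addrAC subrr add0r.
rewrite mulrC divfK ?gt_eqF//.
have := solution_ge0 _ a0; have := phiM (a + (M + 1) / c) ltac:(lra).
by lra.
Qed.

Lemma solution_Phi : Phi R phi.
Proof.
have [C _ _] := sol; split=> //; case: C => phi_fun _ _ _; split => //.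
- move=> s t; rewrite !inE !RplusE => s0 t0 st.
  by apply: contra_eq st; rewrite neq_lt => /orP[] H;
    [rewrite lt_eqF|rewrite gt_eqF] => //; exact: solution_incr.
- move=> x; rewrite RplusE => x0.
  have [b b0 xb] := solution_unbounded x.
  have [||t] := @IVT _ phi 0 b x b0.
  + apply: continuous_subspaceW solution_continuous => t /=.
    by rewrite in_itv RplusE /= => /andP[].
  + by rewrite solution0 ge_min le_max x0 (ltW xb) orbT.
  + by rewrite in_itv/= => /andP[t0 _] <-; exists t; rewrite ?RplusE.
Qed.

End Solution.

(** * Elements of [Phi], their inverses and the fields built from them *)

Section PhiTheory.
Variable phi : R -> R.
Hypothesis phiP : Phi R phi.

Lemma Phi_continuous : {within Rplus R, continuous phi}.
Proof. by case: phiP => -[_ dphi _ _] _; exact: derivable_plus_continuous dphi. Qed.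

Lemma Phi0 : phi 0 = 0. Proof. by case: phiP => -[]. Qed.

Lemma Phi_ge0 t : 0 <= t -> 0 <= phi t.
Proof. by case: phiP => -[+ _ _ _] _ => /(_ t); rewrite !RplusE. Qed.

Lemma Phi_inj s t : 0 <= s -> 0 <= t -> phi s = phi t -> s = t.
Proof.
by case: phiP => _ [_ + _] s0 t0; apply; rewrite inE RplusE.
Qed.

Lemma inverse_path_ge0 x : 0 <= x -> 0 <= inverse_path phi x.
Proof.
case: phiP => _ [_ inj_phi +] x0 => /(_ x); rewrite RplusE => /(_ x0) [t t0 <-].
by rewrite /inverse_path pinvKV ?inE//; move: t0; rewrite RplusE.
Qed.

Lemma phiK t : 0 <= t -> inverse_path phi (phi t) = t.
Proof.
by case: phiP => _ [_ inj_phi _] t0; rewrite /inverse_path pinvKV// inE RplusE.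
Qed.

Lemma inverse_pathK x : 0 <= x -> phi (inverse_path phi x) = x.
Proof.
case: phiP => _ [_ _ +] x0 => /(_ x); rewrite RplusE => /(_ x0) [t + <-].
by rewrite RplusE => t0; rewrite phiK.
Qed.

(** If [phi t <= phi s] with [s < t], then [phi], starting from 0, already takes the value [phi t]
    on [[0, s]], against injectivity. *)
Lemma Phi_incr s t : 0 <= s -> s < t -> phi s < phi t.
Proof.
move=> s0 st; have t0 : 0 <= t by lra.
rewrite ltNge le_eqVlt; apply/negP => /predU1P[/Phi_inj tE|phits].
  by move: st; rewrite tE ?ltxx.
have [||r] := @IVT _ phi 0 s (phi t) s0.
- apply: continuous_subspaceW Phi_continuous => r /=.
  by rewrite in_itv RplusE /= => /andP[].
- by rewrite Phi0 ge_min le_max Phi_ge0// (ltW phits) orbT.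
- by rewrite in_itv/= => /andP[r0 rs] /Phi_inj rE; move: st; rewrite -rE//; lra.
Qed.

Lemma Phi_ndecr s t : 0 <= s -> s <= t -> phi s <= phi t.
Proof. by move=> s0; rewrite le_eqVlt => /predU1P[->//|/(Phi_incr _ _ s0)/ltW]. Qed.

Lemma Phi_lt s t : 0 <= s -> 0 <= t -> (phi s < phi t) = (s < t).
Proof.
move=> s0 t0; apply/idP/idP; last exact: Phi_incr.
by apply: contraTT; rewrite -!leNgt; exact: Phi_ndecr.
Qed.

Lemma Phi_deriv_ge0 t : 0 <= t -> 0 <= deriv_plus phi t.
Proof.
move=> t0; apply: (@deriv_plus_ge0 _ _ (t + 1)) => //; last first.
- by move=> s /andP[ts _]; apply: Phi_ndecr => //; exact: ltW.
- by rewrite ltrDl.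
- by case: phiP => -[_ + _ _] _; apply; rewrite RplusE.
Qed.

Lemma inverse_path_continuous : {within Rplus R, continuous (inverse_path phi)}.
Proof.
apply/continuous_plusP => x x0 e e0; set s := inverse_path phi x.
have s0 : 0 <= s by exact: inverse_path_ge0.
have phisE : phi s = x by exact: inverse_pathK.
(* The distance from [x] to the images of [s - e] and [s + e]. When [s - e < 0] the lower bound on
   the inverse is automatic, and 1 is a placeholder. *)
pose d := Num.min (phi (s + e) - x) (if 0 <= s - e then x - phi (s - e) else 1).
exists d.
  rewrite lt_min -phisE subr_gt0 Phi_incr ?ltrDl//=.
  by case: ifPn => // se; rewrite subr_gt0 Phi_incr// gtrBl.
move=> y y0; rewrite lt_min => /andP[].
set r := inverse_path phi y.
have r0 : 0 <= r by exact: inverse_path_ge0.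
have phirE : phi r = y by exact: inverse_pathK.
rewrite ltr_norml => /andP[_ yse] H.
have rse : r < s + e by rewrite -(Phi_lt r (s + e)) ?phirE; lra.
suff ser : s - e < r by rewrite ltr_norml; apply/andP; split; lra.
move: H; case: ifPn => [se|]; last by lra.
by rewrite -(Phi_lt (s - e) r)// phirE ltr_norml => /andP[]; lra.
Qed.

(** Along the graph of [phi] the two [theta] terms cancel, whatever [theta] is. *)
Lemma field_of_solution theta : global_solution (field_of phi theta) phi.
Proof.
have [C _] := phiP; split; [by []| |exact: Phi0].
by move=> t; rewrite RplusE => t0; rewrite /field_of phiK// addrK.
Qed.

(** With [x = phi s] the field reads [theta t - (theta s - phi' s)]: strict growth in [t] comes from
    [theta], and negative values from the unboundedness of [theta - phi']. *)
Lemma field_of_GG theta : C0_path theta -> strictly_increasing theta ->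
  ereal_sup [set (theta t - deriv_plus phi t)%:E | t in Rplus R] = +oo%E ->
  GG R (field_of phi theta).
Proof.
move=> [ctheta theta0] incr_theta sup_theta.
have incr s t : 0 <= s -> s < t -> theta s < theta t.
  by move=> s0 st; apply: incr_theta => //; rewrite in_itv/= andbT; lra.
split.
- have cont_fst f : {within Rplus R, continuous f} -> forall z : R * R,
      (Rplus R `*` Rplus R) z ->
      f w.1 @[w --> within (Rplus R `*` Rplus R) (nbhs z)] --> f z.1.
    move=> /subspace_continuousP cf z [z1 z2].
    apply: (@cvg_comp _ _ _ fst f _ (within (Rplus R) (nbhs z.1))); last exact: cf.
    move=> U /= H; have : nbhs z.1 [set u | Rplus R u -> U u] by exact: H.
    move=> {}H; have : nbhs z (fst @^-1` [set u | Rplus R u -> U u]) by exact: (cvg_fst H).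
    by apply: filterS => w /= + [w1 _]; apply.
  have cont_snd f : {within Rplus R, continuous f} -> forall z : R * R,
      (Rplus R `*` Rplus R) z ->
      f w.2 @[w --> within (Rplus R `*` Rplus R) (nbhs z)] --> f z.2.
    move=> /subspace_continuousP cf z [z1 z2].
    apply: (@cvg_comp _ _ _ snd f _ (within (Rplus R) (nbhs z.2))); last exact: cf.
    move=> U /= H; have : nbhs z.2 [set u | Rplus R u -> U u] by exact: H.
    move=> {}H; have : nbhs z (snd @^-1` [set u | Rplus R u -> U u]) by exact: (cvg_snd H).
    by apply: filterS => w /= + [_ w2]; apply.
  have cont_inv f : {within Rplus R, continuous f} ->
      {within Rplus R, continuous (f \o inverse_path phi)}.
    move=> /continuous_plusP cf; apply/continuous_plusP => x x0 e e0.
    have [d d0 dP] := cf _ (inverse_path_ge0 _ x0) _ e0.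
    have /continuous_plusP /(_ x x0 d d0)[d' d'0 d'P] := inverse_path_continuous.
    by exists d' => // y y0 yx; apply: dP; [exact: inverse_path_ge0|exact: d'P].
  have cdphi : {within Rplus R, continuous (deriv_plus phi)} by case: phiP => -[].
  apply/subspace_continuousP => z zP.
  apply: cvgB; last exact: (cont_snd _ (cont_inv _ ctheta)).
  by apply: cvgD; [exact: (cont_snd _ (cont_inv _ cdphi))|exact: (cont_fst _ ctheta)].
- have inv0 : inverse_path phi 0 = 0 by rewrite -{1}Phi0 phiK.
  split.
  + by rewrite /field_of inv0 addrK Phi_deriv_ge0.
  + move=> x _ s t; rewrite !in_itv/= !andbT => s0 t0 st.
    by rewrite /field_of ltrD2r ltrD2l incr.
  (* Choose [s] with [theta s - phi' s > theta t]; the field is then negative at [(t, phi s)]. *)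
  + move=> t _; have : ((theta t)%:E < +oo)%E by exact: ltry.
    rewrite -sup_theta => /ereal_sup_gt[_ [s + <-]].
    rewrite RplusE lte_fin => s0 ts.
    apply: (@le_lt_trans _ _ (field_of phi theta t (phi s))%:E).
      by apply: ereal_inf_lbound; exists (phi s) => //; rewrite RplusE Phi_ge0.
    by rewrite lte_fin /field_of phiK//; lra.
  (* At time [s] the field equals [phi' s >= 0], so any later time, here [s + 1], makes it
     positive. *)
  + move=> x; rewrite RplusE => x0; pose s := inverse_path phi x.
    have s0 : 0 <= s by exact: inverse_path_ge0.
    apply: (@lt_le_trans _ _ (field_of phi theta (s + 1) x)%:E).
      rewrite lte_fin /field_of -/s.
      have := incr s (s + 1) s0; have := Phi_deriv_ge0 _ s0.
      by rewrite ltrDl ltr01 => ? /(_ isT); lra.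
    by apply: ereal_sup_ubound; exists (s + 1) => //; rewrite RplusE addr_ge0.
Qed.

End PhiTheory.

(** * Uniqueness of the global solution *)

(* At a maximum m of t - phi^-1 (psi t), psi touches the translate
   t |-> phi (t - d) from above, so psi' m <= phi' (m - d), whereas g is
   strictly larger at time m than at time m - d. *)
Lemma solution_le g phi psi : GG R g ->
  global_solution g phi -> global_solution g psi ->
  forall t, 0 <= t -> phi t <= psi t.
Proof.
move=> gG sphi spsi t1 t10; rewrite leNgt; apply/negP => psiphi.
have phiP := solution_Phi _ _ gG sphi.
have psiP := solution_Phi _ _ gG spsi.
pose u t := inverse_path phi (psi t).
have u0 t : 0 <= t -> 0 <= u t by move=> ?; exact/inverse_path_ge0/Phi_ge0.
have phiu t : 0 <= t -> phi (u t) = psi t.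
  by move=> ?; exact/inverse_pathK/Phi_ge0.
have cu : {within Rplus R, continuous (fun t => t - u t)}.
  apply/continuous_plusP => t t0 e e0; have e20 : 0 < e / 2 by lra.
  have /continuous_plusP /(_ _ (Phi_ge0 _ psiP _ t0) _ e20)[d d0 dP] :=
    inverse_path_continuous _ phiP.
  have /continuous_plusP /(_ _ t0 _ d0)[d' d'0 d'P] := Phi_continuous _ psiP.
  exists (Num.min d' (e / 2)); first by rewrite lt_min d'0.
  move=> s s0; rewrite lt_min => /andP[sd' se].
  have : `|u s - u t| < e / 2 by apply: dP; [exact: Phi_ge0|exact: d'P].
  move: se; rewrite !ltr_norml => /andP[? ?] /andP[? ?].
  by apply/andP; split; lra.
have [|m] := @EVT_max _ (fun t => t - u t) 0 t1 t10.
  apply: continuous_subspaceW cu => t /=.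
  by rewrite in_itv RplusE /= => /andP[].
rewrite in_itv/= => /andP[m0 mt1] max_m.
have ut1 : u t1 < t1 by rewrite -(Phi_lt _ phiP) ?u0// phiu.
have um : u m < m.
  have := max_m t1; rewrite in_itv/= t10 lexx => /(_ isT); lra.
(* Positivity of [u m] and [m] leaves room for left difference quotients at both points. *)
have um_gt0 : 0 < u m.
  rewrite -(Phi_lt _ phiP) ?u0// phiu// (Phi0 _ phiP) -(Phi0 _ psiP).
  by apply: Phi_incr => //; have := u0 _ m0; lra.
have : deriv_plus psi m <= deriv_plus phi (u m).
  apply: deriv_plus_le_left => //.
  - by apply: solution_derivable spsi _ _; rewrite RplusE.
  - by apply: solution_derivable sphi _ _; rewrite RplusE ltW.
  - by have := u0 _ m0; lra.
  - by rewrite phiu.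
  (* Maximality of the delay at [m] says [u m - k <= u (m - k)]; apply the nondecreasing [phi]. *)
  - move=> k k0 km ku; rewrite -phiu ?subr_ge0//.
    apply: Phi_ndecr => //; first by rewrite subr_ge0.
    by have := max_m (m - k); rewrite in_itv/= => /(_ ltac:(apply/andP; split; lra)); lra.
rewrite (solutionE _ _ spsi)// (solutionE _ _ sphi) ?u0// phiu//.
by apply/negP; rewrite -ltNge; apply: GG_incr => //; [exact: Phi_ge0|exact: u0].
Qed.

(** * Existence of a suitable [theta] for each element of [Phi] *)

(** [F t] is the maximum of [f] over [[0, t]]. It inherits continuity because any growth of [F]
    between two times is caused by values of [f] between them. *)
Lemma running_max f : {within Rplus R, continuous f} ->
  exists F, [/\ {within Rplus R, continuous F},
                {in `[0, +oo[ &, {homo F : s t / s <= t}}, F 0 = f 0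
              & forall t, 0 <= t -> f t <= F t].
Proof.
move=> cf.
have /choice[F FP] : forall t, exists y, 0 <= t ->
    (exists2 r, 0 <= r <= t & y = f r) /\ (forall r, 0 <= r <= t -> f r <= y).
  move=> t; have [t0|t0] := leP 0 t; last by exists 0.
  have [|m m_in mP] := @EVT_max _ f 0 t t0.
    apply: continuous_subspaceW cf => r /=.
    by rewrite in_itv RplusE /= => /andP[].
  exists (f m) => _; split; first by exists m => //; move: m_in; rewrite in_itv.
  by move=> r rt; apply: mP; rewrite in_itv.
have ndecrF s t : 0 <= s -> s <= t -> F s <= F t.
  move=> s0 st; have [[r /andP[r0 rs] ->] _] := FP s s0.
  have [_] := FP t (le_trans s0 st); apply.
  by rewrite r0 (le_trans rs).
exists F; split.
- apply/continuous_plusP => t t0 e e0; have e20 : 0 < e / 2 by lra.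
  have /continuous_plusP /(_ t t0 _ e20)[d d0 dP] := cf.
  (* If the maximum over [[0, b]] is attained at some [r > a], then [f r] and [f a] are both within
     [e / 2] of [f t], and [f a <= F a]. *)
  have close a b : 0 <= a -> a <= b -> `|a - t| < d -> `|b - t| < d ->
      F b < F a + e.
    move=> a0 ab ad bd.
    have [[r /andP[r0 rb] ->] _] := FP b (le_trans a0 ab).
    have [_ fF] := FP a a0.
    have [ra|ar] := leP r a.
      by have := fF r; rewrite r0 ra => /(_ isT); lra.
    have := fF a; rewrite a0 lexx => /(_ isT).
    have : `|f r - f t| < e / 2.
      by apply: dP => //; move: ad bd; rewrite !ltr_norml => /andP[? ?] /andP[? ?]; apply/andP; split; lra.
    have := dP a a0 ad; rewrite !ltr_norml => /andP[? ?] /andP[? ?]; lra.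
  exists d => // s s0 sd; have td : `|t - t| < d by rewrite subrr normr0.
  rewrite ltr_norml; have [st|/ltW ts] := leP s t.
    by have := close s t s0 st sd td; have := ndecrF s t s0 st => ? ?; apply/andP; split; lra.
  by have := close t s t0 ts td sd; have := ndecrF t s t0 ts => ? ?; apply/andP; split; lra.
- by move=> s t; rewrite !in_itv/= !andbT => s0 _; exact: ndecrF.
- have [[r /andP[r0 r0'] ->] _] := FP 0 (lexx 0).
  by congr f; apply/eqP; rewrite eq_le r0 r0'.
- by move=> t t0; have [_] := FP t t0; apply; rewrite t0 lexx.
Qed.

Lemma Phi_control phi : Phi R phi -> exists theta,
  [/\ C0_path theta, strictly_increasing theta
    & ereal_sup [set (theta t - deriv_plus phi t)%:E | t in Rplus R] = +oo%E].
Proof.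
move=> phiP; have [[_ _ cdphi _] _] := phiP.
have [F [cF ndecrF F0 dF]] := running_max _ cdphi.
(* The running maximum [F] absorbs [phi'], the linear term gives strict growth and unboundedness,
   and subtracting [F 0] normalizes the value at 0. *)
exists (fun t => t + F t - F 0); split.
- split; last by rewrite add0r subrr.
  apply/continuous_plusP => t t0 e e0; have e20 : 0 < e / 2 by lra.
  have /continuous_plusP /(_ t t0 _ e20)[d d0 dP] := cF.
  exists (Num.min d (e / 2)); first by rewrite lt_min d0.
  move=> s s0; rewrite lt_min => /andP[sd se].
  move: (dP s s0 sd) se; rewrite !ltr_norml => /andP[? ?] /andP[? ?].
  by apply/andP; split; lra.
- move=> s t s0 t0 st; have := ndecrF s t s0 t0 (ltW st); lra.
- apply/eqyP => M _.
  (* Since [phi' t <= F t], the difference is at least [t - F 0], hence at least [M]. *)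
  pose t := Num.max 0 (M + F 0).
  have t0 : 0 <= t by rewrite le_max lexx.
  have tM : M + F 0 <= t by rewrite le_max lexx orbT.
  apply: (@le_trans _ _ (t + F t - F 0 - deriv_plus phi t)%:E).
    by rewrite lee_fin; have := dF t t0; lra.
  by apply: ereal_sup_ubound; exists t => //; rewrite RplusE.
Qed.

End Proofs.

Theorem mainTheorem6 (R : realType) :
  [set phi : R -> R | exists2 g, GG R g & global_solution g phi] = Phi R
  /\
  (forall theta : R -> R, C0_path theta ->
   forall phi : R -> R, Phi R phi ->
     global_solution (field_of phi theta) phi
     /\
     (strictly_increasing theta ->
      ereal_sup [set (theta t - deriv_plus phi t)%:E | t in Rplus R] = +oo%E ->
      GG R (field_of phi theta)
      /\ (forall psi : R -> R, global_solution (field_of phi theta) psi ->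
            forall t, Rplus R t -> psi t = phi t))).
Proof.
split.
  apply/seteqP; split=> [phi [g gG sol]|phi phiP]; first exact: solution_Phi gG sol.
  have [theta [C0 incr sup]] := Phi_control _ phiP.
  by exists (field_of phi theta); [exact: field_of_GG|exact: field_of_solution].
move=> theta C0 phi phiP; have sphi := field_of_solution _ phiP theta.
split=> // incr sup.
have gG := field_of_GG _ phiP _ C0 incr sup; split=> // psi spsi t.
rewrite RplusE => t0; apply/eqP; rewrite eq_le.
by rewrite (solution_le _ _ _ gG spsi sphi)// (solution_le _ _ _ gG sphi spsi).
Qed.
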